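(* Let $\mathcal{G}$ be a connected graph on $N$ vertices. If there exists a symmetric irreducible (entrywise) nonnegative matrix $M\in\mathcal{M}(\mathcal{G})$ with $\mathbf{1}$ as eigenvector and $s$ distinct eigenvalues, then there exist $s-1$ real matrices $A^{(1)},\dots,A^{(s-1)}\in\mathcal{M}(\mathcal{G})$ such that $A^{(s-1)}\cdots A^{(1)}=\frac{1}{N}\mathbf{1}\mathbf{1}^{T}$.
   Context: Graphs are finite, simple and undirected. For a graph $\mathcal{G}=(\mathcal{V},\mathcal{E})$ with vertices $1,\dots,N$, the set of matrices that comply with $\mathcal{G}$ is $$\mathcal{M}(\mathcal{G}) = \{A=[a_{ij}]\in\mathbb{R}^{N\times N} : \text{for all } i\neq j,\ (i,j)\notin\mathcal{E} \Rightarrow a_{ij}=0\}.$$ The vector $\mathbf{1}\in\mathbb{R}^N$ is the column vector of ones. A nonnegative matrix $B\in\mathbb{R}^{N\times N}$ is irreducible if and only if the digraph on $N$ nodes with arc set $\{(i,j) : B_{ji}>0\}$ is strongly connected. *)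

(* Defs.v *)
From mathcomp Require Import all_boot all_order all_algebra.
From mathcomp Require Import reals.

Set Implicit Arguments.
Unset Strict Implicit.
Unset Printing Implicit Defensive.

Import Order.TTheory GRing.Theory Num.Theory.
Local Open Scope ring_scope.

(* A graph with vertices 1, ..., N is given by its adjacency relation [e] on
   ['I_N]; vertex k is the ordinal of value k - 1. *)
Definition simple_graph (N : nat) (e : rel 'I_N) : Prop :=
  symmetric e /\ irreflexive e.

(* For a relation that need not be symmetric this is strong connectedness. *)
Definition strongly_connected (N : nat) (e : rel 'I_N) : Prop :=
  forall i j : 'I_N, connect e i j.

Definition complies (R : realType) (N : nat) (e : rel 'I_N) (A : 'M[R]_N) : Prop :=
  forall i j : 'I_N, i != j -> ~~ e i j -> A i j = 0.

Definition nonneg_mx (R : realType) (N : nat) (A : 'M[R]_N) : Prop :=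
  forall i j : 'I_N, 0 <= A i j.

(* The arc (i, j) is present when the entry (j, i) is positive. The notion is
   only meant for nonnegative matrices. *)
Definition irreducible_nonneg_mx (R : realType) (N : nat) (B : 'M[R]_N) : Prop :=
  nonneg_mx B /\ strongly_connected [rel i j : 'I_N | 0 < B j i].

Definition ones (R : realType) (N : nat) : 'cV[R]_N := const_mx 1.

Definition eigenvector (R : realType) (N : nat) (A : 'M[R]_N) (v : 'cV[R]_N) : Prop :=
  v != 0 /\ exists a : R, A *m v = a *: v.

(* [eigenvalue A] is defined with row vectors, which for a square matrix gives
   the same eigenvalues as column vectors. Only eigenvalues in [R] are counted;
   for a symmetric real matrix these are all of them. *)
Definition has_distinct_eigenvalues (R : realType) (N : nat) (A : 'M[R]_N)
    (s : nat) : Prop :=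
  exists ev : seq R,
    [/\ uniq ev, size ev = s & forall a : R, (a \in ev) = eigenvalue A a].

(* Main.v *)
(* If 1, with eigenvalue a, and the b_k are the eigenvalues of M, the product of
   the factors (M - b_k) / (a - b_k) is p(M) where p(a) = 1 and p(b_k) = 0. By
   the spectral theorem (X - a) p annihilates M, so the rows and columns of p(M)
   are eigenvectors for a. Irreducibility forces those to be constant (a maximum
   principle), so p(M) is a multiple of 1 1^T, and p(M) 1 = 1 gives the factor. *)
Require Import Defs.
From mathcomp Require Import all_boot all_order all_algebra.
From mathcomp Require Import reals.
From mathcomp Require Import complex.
Import Order.TTheory GRing.Theory Num.Theory.
Local Open Scope ring_scope.

(** Over [F[i]] the matrix is Hermitian, so the spectral theorem diagonalizes it with real diagonal
    entries. These are eigenvalues of [M], hence roots of [p]. *)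
Lemma horner_mx_sym_eq0 (F : rcfType) (n : nat) (M : 'M[F]_n.+1) (p : {poly F}) :
  M^T = M -> (forall a, eigenvalue M a -> root p a) -> horner_mx M p = 0.
Proof.
move=> symM rootp; apply: (map_mx_inj (f := real_complex F)).
rewrite map_horner_mx map_mx0.
set Mc := map_mx _ M; set pc := map_poly _ p.
have hermMc : Mc \is hermsymmx.
  apply: realsym_hermsym.
    by apply/is_hermitianmxP; rewrite expr0 scale1r map_mx_id // /Mc map_trmx symM.
  by apply/mxOverP => i j; rewrite mxE complex_real.
have MD := orthomx_spectralP (hermitian_normalmx hermMc).
have dreal := hermitian_spectral_diag_real hermMc.
have Pu := spectral_unit Mc.
move: MD dreal Pu; set P := spectralmx Mc; set d := spectral_diag Mc => MD dreal Pu.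
have pd0 i : pc.[d 0 i] = 0.
  have /mxOverP /(_ 0 i) /complex_realP [r dr] := dreal.
  rewrite dr horner_map /=.
  have /rootp/rootP -> : eigenvalue M r; last by rewrite rmorph0.
  rewrite -(eigenvalue_map (real_complex F)) /= -dr.
  (* Row [i] of [P] is a left eigenvector for [d 0 i], nonzero because [P] is invertible. *)
  apply/eigenvalueP; exists (row i P).
    rewrite -row_mul [X in P *m X]MD !mulmxA mulmxV // mul1mx row_mul.
    by rewrite row_diag_mx -scalemxAl -rowE.
  apply/eqP => P0; have := row_mul i P (invmx P).
  rewrite mulmxV // P0 mul0mx => /rowP/(_ i); rewrite !mxE eqxx => /eqP.
  by rewrite oner_eq0.
rewrite MD horner_mx_uconjC // horner_mx_diag.
rewrite (_ : map_mx _ _ = 0) ?raddf0 ?mulmx0 ?mul0mx //.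
by apply/rowP => i; rewrite !mxE pd0.
Qed.

(* Maximum principle: if [x] is maximal at a vertex, then also at its neighbours. *)
Lemma irreducible_eigenvector_const {R : realType} {N : nat} {M : 'M[R]_N}
    {a : R} (x : 'cV[R]_N) :
  irreducible_nonneg_mx M -> M *m ones R N = a *: ones R N ->
  M *m x = a *: x -> forall i j, x i 0 = x j 0.
Proof.
move=> [M_ge0 Mconn] M1 Mx i.
pose m := [arg max_(m > i) x m 0]%O.
have le_m j : x j 0 <= x m 0 by rewrite /m; case: arg_maxP => // k _; apply.
have step k l : x l 0 = x m 0 -> 0 < M l k -> x k 0 = x m 0.
  move=> xl Mlk.
  (* All row sums of [M] are [a], so the sum is [a * x m 0 - a * x l 0]. Its terms are nonnegative,
     so each one vanishes. *)
  have sum0 : \sum_j M l j * (x m 0 - x j 0) = 0.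
    under eq_bigr do rewrite mulrBr.
    rewrite sumrB; have /matrixP/(_ l 0) := Mx; rewrite !mxE => ->.
    have /matrixP/(_ l 0) := M1; rewrite !mxE.
    under eq_bigr do rewrite mxE mulr1.
    by rewrite -mulr_suml => ->; rewrite xl mulr1 subrr.
  have /eqP := sum0; rewrite psumr_eq0 => [|j _]; last first.
    by rewrite mulr_ge0 ?M_ge0 // subr_ge0.
  move/allP/(_ k (mem_index_enum _))/implyP/(_ isT).
  by rewrite mulf_eq0 gt_eqF //= subr_eq0 => /eqP <-.
suff mx j : x j 0 = x m 0 by move=> j; rewrite !mx.
have /connectP[p] := Mconn j m.
(* The arc from [j] to [k] means [0 < M k j], so maximality passes back along the path from [m]. *)
elim: p j => [|k p IHp] j /= => [_ <- //|/andP[jk pk] mE].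
exact: step (IHp k pk mE) jk.
Qed.

(** The polynomial [p - p.[a]] is a multiple of ['X - a], and [M - a] kills [x]. *)
Lemma horner_mx_eigenvector {F : fieldType} {n : nat} {M : 'M[F]_n.+1}
    {x : 'cV[F]_n.+1} {a : F} (p : {poly F}) :
  M *m x = a *: x -> horner_mx M p *m x = p.[a] *: x.
Proof.
move=> Mx; have /factor_theorem[q pE] : root (p - p.[a]%:P) a.
  by rewrite rootE !hornerE subrr.
rewrite -[p in horner_mx _ p](subrK p.[a]%:P) pE !rmorphD rmorphM /= rmorphB /=.
rewrite !horner_mx_C horner_mx_X mulmxDl mul_scalar_mx -mulmxA mulmxBl Mx.
by rewrite mul_scalar_mx subrr mulmx0 add0r.
Qed.

Lemma horner_mx_irreducible {R : realType} {n : nat} {M : 'M[R]_n.+1} {a : R}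
    (p : {poly R}) :
  M^T = M -> irreducible_nonneg_mx M ->
  M *m ones R n.+1 = a *: ones R n.+1 -> p.[a] = 1 ->
  (forall b, eigenvalue M b -> b != a -> root p b) ->
  horner_mx M p = n.+1%:R^-1 *: (ones R n.+1 *m (ones R n.+1)^T).
Proof.
move=> symM irrM M1 pa1 rootp.
set P := horner_mx M p.
have MP : M *m P = a *: P.
  have : horner_mx M (('X - a%:P) * p) = 0.
    apply: horner_mx_sym_eq0 => // b eb; rewrite rootM root_XsubC.
    by case: eqVneq => //= /(rootp b eb).
  rewrite rmorphM rmorphB /= horner_mx_C horner_mx_X => /eqP.
  by rewrite mulrBl subr_eq0 -mulmxE mul_scalar_mx => /eqP.
have PM : P *m M = a *: P by rewrite -MP; exact: comm_horner_mx.
have colP i i' j : P i j = P i' j.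
  have := irreducible_eigenvector_const (col j P) irrM M1.
  by rewrite colE mulmxA MP -scalemxAl -colE => /(_ erefl i i'); rewrite !mxE.
have rowP i j j' : P i j = P i j'.
  have := irreducible_eigenvector_const (col i P^T) irrM M1.
  rewrite colE mulmxA -[M *m _]trmxK trmx_mul trmxK symM PM linearZ /= -scalemxAl -colE.
  by move=> /(_ erefl j j'); rewrite !mxE.
have sumP i : \sum_j P i j = 1.
  have /matrixP/(_ i 0) := horner_mx_eigenvector p M1; rewrite pa1 scale1r !mxE.
  by under eq_bigr do rewrite mxE mulr1.
apply/matrixP => i j; rewrite !mxE big_ord1 !mxE !mulr1.
(* A constant row of length [n.+1] with sum 1 has entries [n.+1%:R^-1]. *)
have := sumP i; under eq_bigr do rewrite (rowP i _ j).
rewrite sumr_const card_ord -(mulr_natr (P i j)) => Pn.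
by apply: (mulIf (_ : n.+1%:R != 0)); rewrite ?pnatr_eq0 // Pn mulVf ?pnatr_eq0.
Qed.

Theorem corollary8 (R : realType) (N : nat) (e : rel 'I_N) (s : nat) :
  simple_graph e -> strongly_connected e ->
  (exists M : 'M[R]_N,
     complies e M /\ M^T = M /\ irreducible_nonneg_mx M /\
     eigenvector M (ones R N) /\ has_distinct_eigenvalues M s) ->
  exists A : 'I_s.-1 -> 'M[R]_N,
    (forall k : 'I_s.-1, complies e (A k)) /\
    (* [A k] is the (k+1)-st matrix; the highest index is the leftmost factor *)
    \prod_(k < s.-1) A (rev_ord k) = N%:R^-1 *: (ones R N *m (ones R N)^T).
Proof.
move=> _ _ [M [compM [symM [irrM [[nz1 [a M1]] [ev [uev sev evP]]]]]]].
(* For [N = 0] the vector of ones is zero, hence no eigenvector. *)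
case: N e M compM symM irrM nz1 M1 evP => [|n] e M compM symM irrM nz1 M1 evP.
  by move: nz1; rewrite (flatmx0 (ones R 0)) eqxx.
have aev : a \in ev.
  rewrite evP; apply/eigenvalueP; exists (ones R n.+1)^T; last by rewrite trmx_eq0.
  by rewrite -[in LHS]symM -trmx_mul M1 linearZ.
pose bs := rem a ev.
have sbs : size bs = s.-1 by rewrite size_rem // sev.
pose q (k : 'I_s.-1) := (a - bs`_k)^-1 *: ('X - (bs`_k)%:P).
exists (fun k => horner_mx M (q k)); split=> [k i j ij eij|].
  (* Off the diagonal, a polynomial of degree one in [M] is a multiple of [M]. *)
  rewrite horner_mxZ rmorphB /= horner_mx_X horner_mx_C !mxE (negPf ij).
  by rewrite (compM _ _ ij eij) subr0 mulr0.
have -> : \prod_(k < s.-1) horner_mx M (q (rev_ord k)) = horner_mx M (\prod_k q k).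
  (* The order is reversed in the commutative product of polynomials. *)
  by rewrite (reindex_inj rev_ord_inj) rmorph_prod.
apply: (horner_mx_irreducible (a := a)) => // [|b eb ba].
  rewrite horner_prod big1 // => k _; rewrite !hornerE mulVf // subr_eq0.
  have : bs`_k \in bs by rewrite mem_nth ?sbs.
  by rewrite mem_rem_uniq // inE eq_sym => /andP[].
have bbs : b \in bs by rewrite mem_rem_uniq // inE ba evP.
have kP : (index b bs < s.-1)%N by rewrite -sbs index_mem.
rewrite (bigD1 (Ordinal kP)) //= rootM; apply/orP; left.
by rewrite rootE !hornerE nth_index // subrr mulr0.
Qed.
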